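(* For every $k\ge 1$, $k$-Sat* $\le_{ql}$ BigTwoDisjointSets.
   Context: Quasilinear reductions: for an instance $I$ let $s(I)$ be its size. A quasilinear Karp reduction from problem $\mathcal P$ to problem $\mathcal Q$ (written $\mathcal P\le_{ql}\mathcal Q$) is a function $\Phi$ from instances of $\mathcal P$ to instances of $\mathcal Q$ such that for every instance $I$ of $\mathcal P$: $\Phi(I)$ can be computed in time $\tilde O(s(I))$ (that is, $O(s(I)\log^j s(I))$ for a fixed $j$), and $I$ and $\Phi(I)$ have the same output; if the output is not boolean, one additionally requires a linear-time computable function transforming the output of $\Phi(I)$ into the output of $I$. $k$-Sat*: input consists of two sets of boolean variables $\{x_i\}$ and $\{y_j\}$ of the same size, a set $C$ of clauses over these variables each of size at most $k$, the explicit list of all possible evaluations (truth assignments) of the variables $\{x_i\}$, and the explicit list of all possible evaluations of the variables $\{y_j\}$ (so the input size is exponential in the number of variables). Output: True if some evaluation of all variables satisfies all clauses, False otherwise. BigTwoDisjointSets: input is a finite set $X$ and a collection $\mathcal C$ of subsets of $X$ with $|X|<\log^{c}(|\mathcal C|)$, where $c$ is a fixed constant; output True if there are two disjoint sets $C,C'\in\mathcal C$, False otherwise. Sets are represented as lists of their elements. *)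

(* Defs.v *)
From Stdlib Require Import Reals.
From mathcomp Require Import all_boot.

Set Implicit Arguments.
Unset Strict Implicit.
Unset Printing Implicit Defensive.

(* MathComp rebinds the key [R] to its own ring scope. *)
Delimit Scope R_scope with Re.

(** ** Random access machines with logarithmic cost

   "Computable in time T" is read on the Cook-Reckhow RAM: registers hold
   natural numbers, the input is a read-once sequence of naturals, the output
   is a write-only sequence of naturals, and every instruction is charged the
   total bit length of the register addresses and of the contents it touches.
   (Under unit cost, repeated addition would handle exponentially large numbers
   for free.) *)

Definition bitlen (n : nat) : nat := (trunc_log 2 n).+1.

Definition bits (w : seq nat) : nat := sumn (map bitlen w).

(* [ISub] is truncated; [IRead] yields 0 once the input is exhausted; [IJmpz a l]
   jumps to the absolute position [l] when register [a] contains 0. *)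
Inductive instr :=
  | IConst of nat & nat
  | IAdd of nat & nat & nat
  | ISub of nat & nat & nat
  | ILoad of nat & nat
  | IStore of nat & nat
  | IJmpz of nat & nat
  | IRead of nat
  | IWrite of nat.

Definition program := seq instr.

Record config := Config {
  pc : nat;
  reg : nat -> nat;
  inp : seq nat;
  out : seq nat
}.

Definition init (w : seq nat) : config := Config 0 (fun=> 0) w [::].

Definition set_reg (r : nat -> nat) (d v : nat) : nat -> nat :=
  fun a => if a == d then v else r a.

Definition exec (i : instr) (s : config) : config :=
  let: Config p r u w := s in
  match i with
  | IConst d n => Config p.+1 (set_reg r d n) u w
  | IAdd d a b => Config p.+1 (set_reg r d (r a + r b)) u w
  | ISub d a b => Config p.+1 (set_reg r d (r a - r b)) u w
  | ILoad d a => Config p.+1 (set_reg r d (r (r a))) u w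
  | IStore a b => Config p.+1 (set_reg r (r a) (r b)) u w
  | IJmpz a l => Config (if r a == 0 then l else p.+1) r u w
  | IRead d => Config p.+1 (set_reg r d (head 0 u)) (behead u) w
  | IWrite a => Config p.+1 r u (rcons w (r a))
  end.

Definition cost (i : instr) (s : config) : nat :=
  let r := reg s in
  match i with
  | IConst d n => bitlen d + bitlen n
  | IAdd d a b | ISub d a b =>
      bitlen d + bitlen a + bitlen b + bitlen (r a) + bitlen (r b)
  | ILoad d a => bitlen d + bitlen a + bitlen (r a) + bitlen (r (r a))
  | IStore a b => bitlen a + bitlen b + bitlen (r a) + bitlen (r b)
  | IJmpz a _ => bitlen a + bitlen (r a)
  | IRead d => bitlen d + bitlen (head 0 (inp s))
  | IWrite a => bitlen a + bitlen (r a)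
  end.

(* [run M s t s']: started in [s], the program [M] halts in [s'] after time
   [t]. A machine halts when its program counter leaves the program. *)
Inductive run (M : program) : config -> nat -> config -> Prop :=
  | run_halt s : size M <= pc s -> run M s 0 s
  | run_step i s t s' : onth M (pc s) = Some i ->
      run M (exec i s) t s' -> run M s (cost i s + t) s'.

(** ** Decision problems and quasilinear Karp reductions *)

Record problem := Problem {
  instance : Type;
  encode : instance -> seq nat;
  answer : instance -> Prop
}.

Definition isize (P : problem) (I : instance P) : nat := bits (encode I).

Definition quasilinear_time (P Q : problem) (Phi : instance P -> instance Q) :
    Prop :=
  exists (M : program) (time : instance P -> nat),
    (forall I, exists s,
        run M (init (encode I)) (time I) s /\ out s = encode (Phi I)) /\
    exists (A : R) (j N : nat), forall I, N <= isize I ->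
      (INR (time I) <= A * (INR (isize I) * ln (INR (isize I)) ^ j))%Re.

(* The extra output translation needed for non-boolean problems does not arise:
   a [problem] is a decision problem. *)
Definition ql_reduction (P Q : problem) (Phi : instance P -> instance Q) :
    Prop :=
  quasilinear_time Phi /\ forall I, answer I <-> answer (Phi I).

Definition ql_reducible (P Q : problem) : Prop :=
  exists Phi : instance P -> instance Q, ql_reduction Phi.

(* Self-delimiting code of a list: a tag 1 before each item, a final 0. *)
Definition encode_seq (T : Type) (e : T -> seq nat) (s : seq T) : seq nat :=
  foldr (fun a w => 1 :: e a ++ w) [:: 0] s.

(** ** k-Sat* *)

(* [inl i] is the variable x_i and [inr j] the variable y_j; the boolean of a
   literal is the value of its variable that makes it true. *)
Definition literal (n : nat) : Type := (('I_n + 'I_n) * bool)%type.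
Definition clause (n : nat) : Type := seq (literal n).
Definition evaluation (n : nat) : Type := n.-tuple bool.

Definition literal_true (n : nat) (v w : evaluation n) (l : literal n) : bool :=
  match l.1 with
  | inl i => tnth v i == l.2
  | inr j => tnth w j == l.2
  end.

Definition clause_true (n : nat) (v w : evaluation n) (c : clause n) : bool :=
  has (literal_true v w) c.

(* Clauses, literals in a clause and evaluations are listed in any order; only
   syntactic repetitions of a clause are excluded. *)
Record sat_star (k : nat) := SatStar {
  nvar : nat;
  clauses : seq (clause nvar);
  xevals : seq (evaluation nvar);
  yevals : seq (evaluation nvar);
  clauses_uniq : uniq clauses;
  clauses_size : all (fun c : clause nvar => size c <= k) clauses;
  xevals_all : perm_eq xevals (enum {: evaluation nvar});
  yevals_all : perm_eq yevals (enum {: evaluation nvar})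
}.

Definition sat_star_answer (k : nat) (I : sat_star k) : Prop :=
  exists v w : evaluation (nvar I), all (clause_true v w) (clauses I).

Definition encode_literal (n : nat) (l : literal n) : seq nat :=
  match l.1 with
  | inl i => [:: 0; nat_of_ord i; nat_of_bool l.2]
  | inr j => [:: 1; nat_of_ord j; nat_of_bool l.2]
  end.

Definition encode_evaluation (n : nat) (v : evaluation n) : seq nat :=
  map nat_of_bool v.

Definition encode_sat_star (k : nat) (I : sat_star k) : seq nat :=
  nvar I :: encode_seq (encode_seq (@encode_literal _)) (clauses I)
  ++ encode_seq (@encode_evaluation _) (xevals I)
  ++ encode_seq (@encode_evaluation _) (yevals I).

Definition SatStarProblem (k : nat) : problem :=
  Problem (@encode_sat_star k) (@sat_star_answer k).

(** ** BigTwoDisjointSets *)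

Definition log2 (x : R) : R := (ln x / ln 2)%Re.

(* A finite set is a repetition-free list of its elements, which are named by
   natural numbers; two such lists are the same set iff [perm_eq]. Hence
   [coll] is repetition-free as a collection of sets and its size is its
   cardinality. *)
Record big_disjoint_sets (c : nat) := BigDisjointSets {
  ground : seq nat;
  coll : seq (seq nat);
  ground_uniq : uniq ground;
  coll_sets : all uniq coll;
  coll_sub : all (fun S => all (mem ground) S) coll;
  coll_distinct : pairwise (fun S T => ~~ perm_eq S T) coll;
  ground_small : (INR (size ground) < log2 (INR (size coll)) ^ c)%Re
}.

Definition big_disjoint_sets_answer (c : nat) (I : big_disjoint_sets c) : Prop :=
  exists S T : seq nat,
    [/\ S \in coll I, T \in coll I, S != T & ~~ has (mem S) T].

Definition encode_big_disjoint_sets (c : nat) (I : big_disjoint_sets c) :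
    seq nat :=
  encode_seq (fun x => [:: x]) (ground I)
  ++ encode_seq (encode_seq (fun x => [:: x])) (coll I).

Definition BigTwoDisjointSets (c : nat) : problem :=
  Problem (@encode_big_disjoint_sets c) (@big_disjoint_sets_answer c).

(* Main.v *)
From Stdlib Require Import Reals Lra ClassicalEpsilon.
Require Import Defs.
From mathcomp Require Import all_boot zify.

Set Implicit Arguments.
Unset Strict Implicit.
Unset Printing Implicit Defensive.

(** To an evaluation v of the x-variables associate the set of clauses that no
   x-literal of v satisfies, and likewise for the y-variables: the set of v and
   the set of w are disjoint iff (v, w) satisfies every clause. A marker common
   to all x-sets (resp. all y-sets) prevents two sets of the same side from
   being disjoint, and one element per assigned variable makes the sets pairwise
   distinct. The ground set itself is added to the collection: it meets every
   set, and it keeps the logarithm of the number of sets above 1 when there is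
   no variable. There are at most (4n+1)^k clauses, so the ground set is
   polynomial in n, and a machine that stores the clauses and handles one
   evaluation at a time spends time polynomial in n on each of the 2^(n+1)
   evaluations, which is quasilinear since the input lists them all. *)

(** * A structured language compiled to random access machines *)

(* [Loop c1 r c2] runs [c1], exits if variable [r] is 0, and otherwise runs [c2]
   and starts again. *)
Inductive cmd :=
  | Skip
  | Op of instr
  | Seq of cmd & cmd
  | IfNZ of nat & cmd
  | Loop of cmd & nat & cmd.

Fixpoint codelen (c : cmd) : nat :=
  match c with
  | Skip => 0
  | Op _ => 1
  | Seq c1 c2 => codelen c1 + codelen c2
  | IfNZ _ c1 => (codelen c1).+1
  | Loop c1 _ c2 => codelen c1 + (codelen c2).+2
  end.

(** Jumps are absolute, so compilation takes the address [p] of the first instruction. *)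
Fixpoint compile (p : nat) (c : cmd) : program :=
  match c with
  | Skip => [::]
  | Op i => [:: i]
  | Seq c1 c2 => compile p c1 ++ compile (p + codelen c1) c2
  | IfNZ r c1 => IJmpz r (p.+1 + codelen c1) :: compile p.+1 c1
  | Loop c1 r c2 =>
      compile p c1
      ++ IJmpz r (p + codelen c1 + (codelen c2).+2)
      :: compile (p + codelen c1).+1 c2 ++ [:: IJmpz 0 p]
  end.

(* Registers below [nvars] hold the program variables, and indirect accesses
   are confined to the registers above; register 0 always contains 0, so that a
   conditional jump on it is unconditional. *)
Definition nvars := 16.

(** The variables form a list so that symbolic execution computes; [memory] describes registers only
    from address [nvars] on. *)
Record state := State {
  vars : seq nat;
  memory : nat -> nat;
  sinp : seq nat;
  sout : seq nat
}.

(** A nonzero destination preserves the 0 in register 0; jumps arise only from compilation. *)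
Definition op_wf (i : instr) : bool :=
  match i with
  | IConst d _ => 0 < d < nvars
  | IAdd d a b | ISub d a b => [&& 0 < d < nvars, a < nvars & b < nvars]
  | ILoad d a => (0 < d < nvars) && (a < nvars)
  | IStore a b => (a < nvars) && (b < nvars)
  | IJmpz _ _ => false
  | IRead d => 0 < d < nvars
  | IWrite a => a < nvars
  end.

Fixpoint cmd_wf (c : cmd) : bool :=
  match c with
  | Skip => true
  | Op i => op_wf i
  | Seq c1 c2 => cmd_wf c1 && cmd_wf c2
  | IfNZ r c1 => (r < nvars) && cmd_wf c1
  | Loop c1 r c2 => [&& r < nvars, cmd_wf c1 & cmd_wf c2]
  end.

(** Conditions left to each execution: new values stay at most [V], and indirect accesses avoid the
    variables. Subtracted, loaded and read values inherit the bound from the state. *)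
Definition op_pre (V : nat) (i : instr) (s : state) : Prop :=
  let v := nth 0 (vars s) in
  match i with
  | IConst _ n => n <= V
  | IAdd _ a b => v a + v b <= V
  | ILoad _ a => nvars <= v a
  | IStore a _ => nvars <= v a
  | _ => True
  end.

Definition op_exec (i : instr) (s : state) : state :=
  let: State v m u w := s in
  match i with
  | IConst d n => State (set_nth 0 v d n) m u w
  | IAdd d a b => State (set_nth 0 v d (nth 0 v a + nth 0 v b)) m u w
  | ISub d a b => State (set_nth 0 v d (nth 0 v a - nth 0 v b)) m u w
  | ILoad d a => State (set_nth 0 v d (m (nth 0 v a))) m u w
  | IStore a b => State v (set_reg m (nth 0 v a) (nth 0 v b)) u w
  | IJmpz _ _ => s
  | IRead d => State (set_nth 0 v d (head 0 u)) m (behead u) w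
  | IWrite a => State v m u (rcons w (nth 0 v a))
  end.

(* [ev V c s t s']: [c] leads from [s] to [s'] in at most [t] machine steps, all
   the values computed being at most [V]; time is then at most [t * 5 * bitlen V]. *)
Inductive ev (V : nat) : cmd -> state -> nat -> state -> Prop :=
  | ev_skip s : ev V Skip s 0 s
  | ev_op i s : op_pre V i s -> ev V (Op i) s 1 (op_exec i s)
  | ev_seq c1 c2 s1 t1 s2 t2 s3 :
      ev V c1 s1 t1 s2 -> ev V c2 s2 t2 s3 -> ev V (Seq c1 c2) s1 (t1 + t2) s3
  | ev_if0 r c s : nth 0 (vars s) r = 0 -> ev V (IfNZ r c) s 1 s
  | ev_if1 r c s t s' : 0 < nth 0 (vars s) r -> ev V c s t s' ->
      ev V (IfNZ r c) s t.+1 s'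
  | ev_loop0 c1 r c2 s1 t s2 :
      ev V c1 s1 t s2 -> nth 0 (vars s2) r = 0 -> ev V (Loop c1 r c2) s1 t.+1 s2
  | ev_loop1 c1 r c2 s1 t1 s2 t2 s3 t3 s4 :
      ev V c1 s1 t1 s2 -> 0 < nth 0 (vars s2) r -> ev V c2 s2 t2 s3 ->
      ev V (Loop c1 r c2) s3 t3 s4 ->
      ev V (Loop c1 r c2) s1 (t1 + t2 + t3).+2 s4
  | ev_weak c s t t' s' : ev V c s t s' -> t <= t' -> ev V c s t' s'.

(** * Simulation of commands by the machine *)

Definition bounded (V : nat) (s : state) : Prop :=
  [/\ size (vars s) = nvars, nth 0 (vars s) 0 = 0,
      (forall a, nth 0 (vars s) a <= V), (forall a, memory s a <= V)
    & all (fun x => x <= V) (sinp s)].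

Definition represents (s : state) (cf : config) : Prop :=
  [/\ (forall a, reg cf a = if a < nvars then nth 0 (vars s) a else memory s a),
      inp cf = sinp s & out cf = sout s].

(** Runs without the halting requirement, so that they compose. *)
Inductive steps (M : program) : config -> nat -> config -> Prop :=
  | steps_refl s : steps M s 0 s
  | steps_step i s t s' : onth M (pc s) = Some i ->
      steps M (exec i s) t s' -> steps M s (cost i s + t) s'.

Lemma steps_trans M s1 t1 s2 t2 s3 :
  steps M s1 t1 s2 -> steps M s2 t2 s3 -> steps M s1 (t1 + t2) s3.
Proof.
elim=> [//|i s t s' Hi _ IH] H; rewrite -addnA; apply: steps_step => //.
exact: IH.
Qed.

Lemma steps_run M s t s' : steps M s t s' -> size M <= pc s' -> run M s t s'.
Proof.
elim=> [s0|i s0 t0 s1 Hi _ IH] H; first exact: run_halt.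
by apply: run_step => //; apply: IH.
Qed.

Lemma steps1 M i s : onth M (pc s) = Some i -> steps M s (cost i s) (exec i s).
Proof.
move=> Hi; rewrite -[cost i s]addn0; apply: steps_step => //; exact: steps_refl.
Qed.

Lemma size_compile p c : size (compile p c) = codelen c.
Proof.
elim: c p => //= [c1 IH1 c2 IH2|r c IH|c1 IH1 r c2 IH2] p.
- by rewrite size_cat IH1 IH2.
- by rewrite IH.
- by rewrite size_cat /= size_cat IH1 IH2 /= addn1.
Qed.

Lemma onth_middle (A : seq instr) i B : onth (A ++ i :: B) (size A) = Some i.
Proof. by elim: A. Qed.

Lemma leq_bitlen m n : m <= n -> bitlen m <= bitlen n.
Proof. by move=> H; rewrite ltnS leq_trunc_log. Qed.

(** An instruction is charged for at most five numbers, each a variable address or a value and so at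
    most [V]. *)
Lemma op_cost V i s cf : nvars <= V -> op_wf i -> op_pre V i s -> bounded V s ->
  represents s cf -> cost i cf <= 5 * bitlen V.
Proof.
move=> HV Hwf Hp [Hsz H0 Hv Hm Hi] [Hr Hin _].
have Hreg a : reg cf a <= V by rewrite Hr; case: ifP.
have Hb a : bitlen (reg cf a) <= bitlen V by apply: leq_bitlen.
have Hs a : a < nvars -> bitlen a <= bitlen V.
  by move=> Ha; apply: leq_bitlen; apply: leq_trans HV; apply: ltnW.
have Hh : bitlen (head 0 (inp cf)) <= bitlen V.
  by apply: leq_bitlen; rewrite Hin; case: (sinp s) Hi => //= a l /andP[].
case: i Hwf Hp => /= [d n|d a b|d a b|d a|a b|a l|d|a].
- move=> /andP[_ /Hs ?] /leq_bitlen; lia.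
- by move=> /and3P[/andP[_ /Hs ?] /Hs ? /Hs ?] _; move: (Hb a) (Hb b); lia.
- by move=> /and3P[/andP[_ /Hs ?] /Hs ? /Hs ?] _; move: (Hb a) (Hb b); lia.
- by move=> /andP[/andP[_ /Hs ?] /Hs ?] _; move: (Hb a) (Hb (reg cf a)); lia.
- by move=> /andP[/Hs ? /Hs ?] _; move: (Hb a) (Hb b); lia.
- by [].
- by move=> /andP[_ /Hs ?] _; lia.
- by move=> /Hs ? _; move: (Hb a); lia.
Qed.

Lemma op_bounded V i s : op_wf i -> op_pre V i s -> bounded V s ->
  bounded V (op_exec i s).
Proof.
case: s => v m u w Hwf Hp [/= Hsz H0 Hv Hm Hi].
have Hset d x : 0 < d < nvars -> x <= V -> bounded V (State (set_nth 0 v d x) m u w).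
  move=> /andP[Hd Hd'] Hx; split=> //=.
  - by rewrite size_set_nth Hsz; apply/maxn_idPr.
  - by rewrite nth_set_nth /=; case: eqP => // E; rewrite -E in Hd.
  - by move=> a; rewrite nth_set_nth /=; case: eqP.
case: i Hwf Hp => /= [d n|d a b|d a b|d a|a b|a l|d|a].
- by move=> *; apply: Hset.
- by move=> /and3P[? _ _] ?; apply: Hset.
- by move=> /and3P[? _ _] _; apply: Hset => //; apply: leq_trans (leq_subr _ _) _.
- by move=> /andP[? _] _; apply: Hset.
- by move=> _ _; split=> //= c; rewrite /set_reg; case: eqP.
- by [].
- move=> Hd _.
  have Hh : head 0 u <= V by move: Hi; case: (u) => //= ? ? /andP[].
  have [? ? ? ? ?] := Hset _ _ Hd Hh; split=> //=.
  by move: Hi; case: (u) => //= ? ? /andP[].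
- by [].
Qed.

Lemma op_represents V i s cf : op_wf i -> op_pre V i s -> size (vars s) = nvars ->
  represents s cf -> represents (op_exec i s) (exec i cf).
Proof.
case: s cf => v m u w [p r u' w'] Hwf Hp /= Hsz [/= Hr -> ->].
have Hset d x : 0 < d < nvars ->
    forall a, set_reg r d x a = if a < nvars then nth 0 (set_nth 0 v d x) a else m a.
  move=> /andP[_ Hd] a; rewrite /set_reg nth_set_nth /= Hr.
  by case: eqP => [->|//]; rewrite Hd.
case: i Hwf Hp => /= [d n|d a b|d a b|d a|a b|a l|d|a].
- by move=> Hd _; split=> //=; apply: Hset.
- by move=> /and3P[Hd Ha Hb] _; split=> //=; rewrite !Hr Ha Hb; apply: Hset.
- by move=> /and3P[Hd Ha Hb] _; split=> //=; rewrite !Hr Ha Hb; apply: Hset.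
- move=> /andP[Hd Ha] Hp; split=> //=; rewrite [r a]Hr Ha Hr ltnNge Hp /=.
  exact: Hset.
- move=> /andP[Ha Hb] Hp; split=> //= c.
  rewrite /set_reg !Hr Ha Hb; case: eqP => [->|//].
  by rewrite ltnNge Hp.
- by [].
- by move=> Hd _; split=> //=; apply: Hset.
- by move=> Ha _; split=> //=; rewrite Hr Ha.
Qed.

Lemma op_pc i cf : op_wf i -> pc (exec i cf) = (pc cf).+1.
Proof. by case: cf => p r u w; case: i. Qed.

(** Induction on the evaluation. The context [A], [B] places the code at address [size A], the one
    it is compiled for, and each counted step is one instruction of cost at most [5 * bitlen V]. *)
Lemma ev_steps V c s t s' : nvars <= V -> ev V c s t s' -> forall M A B cf,
  cmd_wf c -> bounded V s -> represents s cf -> pc cf = size A ->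
  M = A ++ compile (size A) c ++ B ->
  bounded V s' /\ exists t' cf',
    [/\ steps M cf t' cf', t' <= t * (5 * bitlen V), represents s' cf'
      & pc cf' = size A + codelen c].
Proof.
move=> HV; have jmp r l (s0 : state) cf : r < nvars -> bounded V s0 -> represents s0 cf ->
    [/\ cost (IJmpz r l) cf <= 5 * bitlen V,
        represents s0 (exec (IJmpz r l) cf)
      & pc (exec (IJmpz r l) cf)
        = if nth 0 (vars s0) r == 0 then l else (pc cf).+1].
  move=> Hr Hb Hrep.
  (* A jump on [r] costs as much as writing [r], an operation covered by [op_cost]. *)
  have /= H := @op_cost V (IWrite r) s0 cf HV Hr I Hb Hrep.
  case: cf Hrep H => p rg u w [/= Hrg Hu Hw] H; split=> //.
  by rewrite Hrg Hr.
elim=> {c s t s'}.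
- move=> s M A B cf _ Hb Hrep Hpc _; split=> //; exists 0, cf.
  by split=> //; [apply: steps_refl|rewrite addn0].
- move=> i s Hp M A B cf Hwf Hb Hrep Hpc ->; split; first exact: op_bounded.
  exists (cost i cf), (exec i cf); split.
  + by apply: steps1; rewrite Hpc /= onth_middle.
  + by rewrite mul1n; apply: op_cost HV Hwf Hp Hb Hrep.
  + by apply: op_represents Hwf Hp _ Hrep; case: Hb.
  + by rewrite op_pc // Hpc /= addn1.
- move=> c1 c2 s1 t1 s2 t2 s3 _ IH1 _ IH2 M A B cf /= /andP[W1 W2] Hb Hrep Hpc EM.
  have [|Hb2 [t1' [cf2 [St1 Ht1 Hrep2 Hpc2]]]] :=
    IH1 M A (compile (size A + codelen c1) c2 ++ B) cf W1 Hb Hrep Hpc.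
    by rewrite EM -!catA.
  have [||Hb3 [t2' [cf3 [St2 Ht2 Hrep3 Hpc3]]]] :=
    IH2 M (A ++ compile (size A) c1) B cf2 W2 Hb2 Hrep2.
  + by rewrite Hpc2 size_cat size_compile.
  + by rewrite EM size_cat size_compile -!catA.
  split=> //; exists (t1' + t2'), cf3; split=> //.
  + exact: steps_trans St1 St2.
  + by rewrite mulnDl leq_add.
  + by rewrite Hpc3 size_cat size_compile addnA.
- move=> r c s Hz M A B cf /= /andP[Hr W] Hb Hrep Hpc EM; split=> //.
  have [Hc Hrep' Hpc'] := jmp r (size A + (codelen c).+1) _ _ Hr Hb Hrep.
  eexists _, _; split; [|by rewrite mul1n; exact: Hc|exact: Hrep'|].
  + by apply: steps1; rewrite Hpc EM addSnnS onth_middle.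
  + by rewrite Hpc' Hz.
- move=> r c s t s' Hz _ IH M A B cf /= /andP[Hr W] Hb Hrep Hpc EM.
  have [Hc Hrep' Hpc'] := jmp r (size A + (codelen c).+1) _ _ Hr Hb Hrep.
  have S1 : steps M cf (cost (IJmpz r (size A + (codelen c).+1)) cf)
      (exec (IJmpz r (size A + (codelen c).+1)) cf).
    by apply: steps1; rewrite Hpc EM addSnnS onth_middle.
  have [||Hb3 [t2' [cf3 [St2 Ht2 Hrep3 Hpc3]]]] :=
    IH M (rcons A (IJmpz r (size A + (codelen c).+1))) B _ W Hb Hrep'.
  + by rewrite Hpc' eqn0Ngt Hz Hpc size_rcons.
  + by rewrite EM size_rcons -cats1 -!catA /= addSnnS.
  split=> //; eexists _, _; split; [exact: steps_trans S1 St2| |exact: Hrep3|].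
  + by rewrite mulSn leq_add.
  + by rewrite Hpc3 size_rcons addSnnS.
- move=> c1 r c2 s1 t s2 _ IH1 Hz M A B cf /= /and3P[Hr W1 W2] Hb Hrep Hpc EM.
  have [|Hb2 [t1' [cf2 [St1 Ht1 Hrep2 Hpc2]]]] :=
    IH1 M A
      (IJmpz r (size A + codelen c1 + (codelen c2).+2)
       :: compile (size A + codelen c1).+1 c2 ++ IJmpz 0 (size A) :: B)
      cf W1 Hb Hrep Hpc.
    by rewrite EM /= -!catA /= -!catA.
  have [Hc Hrep' Hpc'] := jmp r (size A + codelen c1 + (codelen c2).+2) _ _ Hr Hb2 Hrep2.
  have S1 : steps M cf2 (cost (IJmpz r (size A + codelen c1 + (codelen c2).+2)) cf2)
      (exec (IJmpz r (size A + codelen c1 + (codelen c2).+2)) cf2).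
    apply: (@steps1 M (IJmpz r (size A + codelen c1 + (codelen c2).+2))).
    by rewrite Hpc2 -{1}(size_compile (size A) c1) -size_cat EM -!catA catA /= onth_middle.
  split=> //; eexists _, _; split; [exact: steps_trans St1 S1| |exact: Hrep'|].
  + by rewrite mulSn addnC leq_add.
  + by rewrite Hpc' Hz /= -!addnA.
- move=> c1 r c2 s1 t1 s2 t2 s3 t3 s4 _ IH1 Hz _ IH2 _ IH3 M A B cf W Hb Hrep Hpc EM.
  move: (W) => /= /and3P[Hr W1 W2]; move: (EM) => /= EM'.
  have [|Hb2 [t1' [cf2 [St1 Ht1 Hrep2 Hpc2]]]] :=
    IH1 M A
      (IJmpz r (size A + codelen c1 + (codelen c2).+2)
       :: compile (size A + codelen c1).+1 c2 ++ IJmpz 0 (size A) :: B)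
      cf W1 Hb Hrep Hpc.
    by rewrite EM' -!catA /= -!catA.
  set J := IJmpz r (size A + codelen c1 + (codelen c2).+2).
  have [Hc Hrep' Hpc'] := jmp r (size A + codelen c1 + (codelen c2).+2) _ _ Hr Hb2 Hrep2.
  rewrite -/J in Hc Hrep' Hpc'.
  have S1 : steps M cf2 (cost J cf2) (exec J cf2).
    apply: (@steps1 M J).
    by rewrite Hpc2 -{1}(size_compile (size A) c1) -size_cat EM' -!catA catA /= onth_middle.
  have [||Hb3 [t2' [cf3 [St2 Ht2 Hrep3 Hpc3]]]] :=
    IH2 M (A ++ rcons (compile (size A) c1) J) (IJmpz 0 (size A) :: B) _ W2 Hb2 Hrep'.
  + by rewrite Hpc' eqn0Ngt Hz /= Hpc2 size_cat size_rcons size_compile addnS.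
  + by rewrite EM' size_cat size_rcons size_compile (addnS _ (codelen c1)) -cats1 -!catA /= -!catA.
  (* The closing jump tests register 0, which holds 0, so control returns to the start of the loop
     and [IH3] applies. *)
  have [Hc' Hrep3' Hpc3'] := jmp 0 (size A) _ _ isT Hb3 Hrep3.
  have S3 : steps M cf3 (cost (IJmpz 0 (size A)) cf3) (exec (IJmpz 0 (size A)) cf3).
    apply: (@steps1 M (IJmpz 0 (size A))).
    set X := compile (size A + codelen c1).+1 c2.
    have -> : M = ((A ++ rcons (compile (size A) c1) J) ++ X) ++ IJmpz 0 (size A) :: B.
      by rewrite EM' -cats1 -!catA /= -!catA.
    by rewrite Hpc3 -(size_compile (size A + codelen c1).+1 c2) -size_cat onth_middle.
  have Hz3 : nth 0 (vars s3) 0 = 0 by case: Hb3.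
  rewrite Hz3 /= in Hpc3'.
  have [Hb4 [t4' [cf4 [St4 Ht4 Hrep4 Hpc4]]]] := IH3 M A B _ W Hb3 Hrep3' Hpc3' EM.
  split=> //; eexists _, _; split; [|  |exact: Hrep4|exact: Hpc4].
  + exact: (steps_trans St1 (steps_trans S1 (steps_trans St2 (steps_trans S3 St4)))).
  + move: Hc Hc'; rewrite !mulSn !mulnDl; lia.
- move=> c s t t' s' _ IH Ht M A B cf W Hb Hrep Hpc EM.
  have [Hb' [t0 [cf' [? ? ? ?]]]] := IH M A B cf W Hb Hrep Hpc EM.
  split=> //; exists t0, cf'; split=> //.
  by apply: (leq_trans (n := t * (5 * bitlen V))) => //; rewrite leq_mul2r Ht orbT.
Qed.

Lemma ev_run V c t w s' :
  ev V c (State (nseq nvars 0) (fun=> 0) w [::]) t s' ->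
  cmd_wf c -> nvars <= V -> all (fun x => x <= V) w ->
  exists t' cf, [/\ run (compile 0 c) (init w) t' cf, t' <= t * (5 * bitlen V)
    & out cf = sout s'].
Proof.
move=> E W HV Hw.
have H0 a : nth 0 (nseq nvars 0) a = 0 by rewrite nth_nseq; case: ifP.
have Hb : bounded V (State (nseq nvars 0) (fun=> 0) w [::]).
  by split=> // a; rewrite [nth _ _ _]H0.
have [|||_ [t' [cf [St Ht [_ _ Ho] Hpc]]]] :=
  ev_steps HV E (M := compile 0 c) (A := [::]) (B := [::]) (cf := init w) W Hb.
- by split=> // a; rewrite [nth _ _ _]H0; case: ifP.
- by [].
- by rewrite /= cats0.
exists t', cf; split=> //; apply: steps_run St _.
by rewrite Hpc size_compile.
Qed.

(** * The machine of the reduction *)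

(* [rT] holds the address 18 of a table with one cell per literal, [rCS] the
   address of the stored clauses, just after the table, and [rM] the number of
   clauses; [rMK] is the marker of the current side and [rBS] the address of its
   first literal. *)
Notation rZ := 0 (only parsing).
Notation rONE := 1 (only parsing).
Notation rN := 2 (only parsing).
Notation rN2 := 3 (only parsing).
Notation rT := 4 (only parsing).
Notation rCS := 5 (only parsing).
Notation rM := 6 (only parsing).
Notation rX := 7 (only parsing).
Notation rP := 8 (only parsing).
Notation rCNT := 9 (only parsing).
Notation rA := 10 (only parsing).
Notation rB := 11 (only parsing).
Notation rU := 12 (only parsing).
Notation rG := 13 (only parsing).
Notation rMK := 14 (only parsing).
Notation rBS := 15 (only parsing).

Notation "c1 ;; c2" := (Seq c1 c2) (at level 60, right associativity).

Definition print_range : cmd :=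
  Loop Skip rCNT
    (Op (IWrite rONE);; Op (IWrite rX);;
     Op (IAdd rX rX rONE);; Op (ISub rCNT rCNT rONE)).

(** The address computed is [18 + 2i + b], with [2n] more for a y-literal. The last two constants
    restore the zeros assumed at the next round. *)
Definition read_literal : cmd :=
  Op (IRead rA);; Op (IRead rB);; Op (IAdd rB rB rB);; Op (IAdd rB rT rB);;
  IfNZ rA (Op (IAdd rB rB rN2));;
  Op (IRead rA);; Op (IAdd rB rB rA);;
  Op (IStore rP rB);; Op (IAdd rP rP rONE);;
  Op (IConst rA 0);; Op (IConst rB 0).

(** The input is read once and does not announce the number of clauses, so the name of each clause
    is printed into the ground set as the clause is stored. *)
Definition read_clause : cmd :=
  Op (IWrite rONE);; Op (IWrite rX);; Op (IAdd rX rX rONE);; Op (IAdd rM rM rONE);;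
  Loop (Op (IRead rU)) rU read_literal;;
  Op (IStore rP rZ);; Op (IAdd rP rP rONE).

Definition clear_table : cmd :=
  Loop Skip rCNT
    (Op (IStore rP rZ);; Op (IAdd rP rP rONE);; Op (ISub rCNT rCNT rONE)).

(** The sum of [rX] and the bit read is both the cell marked and the element printed; a variable
    takes two consecutive numbers. *)
Definition read_evaluation : cmd :=
  Loop Skip rCNT
    (Op (IRead rA);; Op (IAdd rA rX rA);; Op (IStore rA rONE);;
     Op (IWrite rONE);; Op (IWrite rA);;
     Op (IAdd rX rX rONE);; Op (IAdd rX rX rONE);;
     Op (ISub rCNT rCNT rONE);; Op (IConst rA 0)).

Definition count_true : cmd :=
  Loop (Op (ILoad rU rP);; Op (IAdd rP rP rONE)) rU
    (Op (ILoad rB rU);; Op (IAdd rA rA rB)).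

(** Truncated subtraction turns the number of true literals into a test: [1 - rA] is nonzero only if
    there is none. *)
Definition print_unsat : cmd :=
  Loop Skip rCNT
    (count_true;; Op (ISub rA rONE rA);;
     IfNZ rA (Op (IWrite rONE);; Op (IWrite rX));;
     Op (IAdd rX rX rONE);; Op (ISub rCNT rCNT rONE);;
     Op (IConst rA 0);; Op (IConst rB 0)).

(** The two leading tags announce the set in the collection and the marker in the set. [rCS] is both
    the address of the stored clauses and the name of the first clause. *)
Definition print_set : cmd :=
  Op (IWrite rONE);; Op (IWrite rONE);; Op (IWrite rMK);;
  Op (IAdd rP rT rZ);; Op (ISub rCNT rCS rT);; clear_table;;
  Op (IAdd rX rBS rZ);; Op (IAdd rCNT rN rZ);; read_evaluation;;
  Op (IAdd rP rCS rZ);; Op (IAdd rX rCS rZ);; Op (IAdd rCNT rM rZ);;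
  print_unsat;; Op (IWrite rZ).

Definition print_sets : cmd := Loop (Op (IRead rG)) rG print_set.

(** Addresses below 16 hold the variables, 16 and 17 name the markers, and the table starts at 18.
    The ground set is printed twice, as the ground list and as the last member of the collection;
    the final zeros end that member and the collection. *)
Definition reduction_cmd : cmd :=
  Op (IConst rONE 1);; Op (IRead rN);; Op (IAdd rN2 rN rN);;
  Op (IConst rT 18);; Op (IAdd rCS rT rN2);; Op (IAdd rCS rCS rN2);;
  Op (IConst rX 16);; Op (ISub rCNT rCS rX);; print_range;;
  Op (IAdd rP rCS rZ);; Loop (Op (IRead rG)) rG read_clause;; Op (IWrite rZ);;
  Op (IConst rMK 16);; Op (IAdd rBS rT rZ);; print_sets;;
  Op (IAdd rMK rMK rONE);; Op (IAdd rBS rBS rN2);; print_sets;;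
  Op (IWrite rONE);; Op (IConst rX 16);; Op (IAdd rCNT rCS rM);;
  Op (ISub rCNT rCNT rX);; print_range;; Op (IWrite rZ);; Op (IWrite rZ).

(** * Codes of lists, literals and clauses, and memory contents *)

Definition items (T : Type) (e : T -> seq nat) (s : seq T) : seq nat :=
  flatten [seq 1 :: e a | a <- s].

Definition encode_set : seq nat -> seq nat := encode_seq (fun x => [:: x]).

Lemma encode_seqE (T : Type) (e : T -> seq nat) s :
  encode_seq e s = items e s ++ [:: 0].
Proof. by elim: s => //= a s ->; rewrite /items /= -catA. Qed.

(** Unlike [encode_seq], [items] has no terminator, so output printed in pieces can be assembled. *)
Lemma items_cat (T : Type) (e : T -> seq nat) s1 s2 :
  items e (s1 ++ s2) = items e s1 ++ items e s2.
Proof. by rewrite /items map_cat flatten_cat. Qed.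

(* A literal is coded by the address of its cell in the table, and the same
   number names the element of the ground set that records the corresponding
   assignment. The markers of the x- and y-sets are 16 and 17, and the j-th clause
   is named 18 + 4n + j. *)
Definition literal_code (n : nat) (l : literal n) : nat :=
  match l.1 with
  | inl i => 18 + (i + i) + l.2
  | inr j => 18 + (j + j) + (n + n) + l.2
  end.

(** Elements recording an assignment: [q] is the code of the first literal of the side, and each
    variable owns two consecutive codes. *)
Fixpoint bit_codes (q : nat) (bs : seq bool) : seq nat :=
  if bs is b :: bs' then q + b :: bit_codes q.+2 bs' else [::].

(** [E] lists the true literals; a clause consumes its name even when it is left out. *)
Fixpoint unsat (E : seq nat) (x : nat) (cs : seq (seq nat)) : seq nat :=
  if cs is c :: cs' then
    if has (mem E) c then unsat E x.+1 cs' else x :: unsat E x.+1 cs'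
  else [::].

(* Literal codes are nonzero, so that 0 can end a clause. *)
Definition clauses_code (cs : seq (seq nat)) : seq nat :=
  flatten [seq rcons c 0 | c <- cs].

Fixpoint write_mem (M : nat -> nat) (p : nat) (l : seq nat) : nat -> nat :=
  if l is x :: l' then write_mem (set_reg M p x) p.+1 l' else M.

Definition mark_mem (M : nat -> nat) (l : seq nat) : nat -> nat :=
  foldl (fun M' a => set_reg M' a 1) M l.

Definition holds (M : nat -> nat) (p : nat) (l : seq nat) : Prop :=
  forall i, i < size l -> M (p + i) = nth 0 l i.

Lemma write_mem_cat M p l1 l2 :
  write_mem M p (l1 ++ l2) = write_mem (write_mem M p l1) (p + size l1) l2.
Proof. by elim: l1 M p => [|x l IH] M p /=; rewrite ?addn0 // IH addnS. Qed.

Lemma write_memE M p l a : write_mem M p l a =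
  if p <= a < p + size l then nth 0 l (a - p) else M a.
Proof.
elim: l M p => [|x l IH] M p /=; first by rewrite addn0 ltnNge andbN.
rewrite IH /set_reg; case: (ltngtP p a) => [pa|ap|<-] /=.
- rewrite addSnnS; case: ifP => // _; by rewrite -[a - p]prednK ?subn_gt0 // subnS.
- by [].
- by rewrite subnn addnS ltnS leq_addr.
Qed.

Lemma mark_memE M l a : mark_mem M l a = if a \in l then 1 else M a.
Proof.
rewrite /mark_mem; elim: l M => //= x l IH M; rewrite IH in_cons /set_reg.
by case: (a \in l); rewrite ?orbT // orbF.
Qed.

Lemma holds_write_mem M p l : holds (write_mem M p l) p l.
Proof. by move=> i Hi; rewrite write_memE leq_addr ltn_add2l Hi addKn. Qed.

Lemma holds_cat M p l1 l2 :
  holds M p (l1 ++ l2) -> holds M p l1 /\ holds M (p + size l1) l2.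
Proof.
move=> H; split=> i Hi.
  by rewrite H ?nth_cat ?Hi // size_cat ltn_addr.
by rewrite -addnA H ?nth_cat ?size_cat ?ltn_add2l // ltnNge leq_addr /= addKn.
Qed.

Lemma bit_codes_range q bs a : a \in bit_codes q bs ->
  q <= a < q + (size bs).*2.
Proof.
elim: bs q => //= b bs IH q; rewrite in_cons => /orP[/eqP->|/IH]; last lia.
by case: b; lia.
Qed.

Lemma literal_code_range n (l : literal n) :
  18 <= literal_code l < 18 + (n + n) + (n + n).
Proof.
case: l => [[i|i] b]; rewrite /literal_code /=; have := ltn_ord i; case: b; lia.
Qed.

(** * Execution of the machine's commands *)

Lemma ev_to V c s t0 s0 t s' :
  ev V c s t0 s0 -> t0 <= t -> s0 = s' -> ev V c s t s'.
Proof. by move=> H Ht <-; apply: ev_weak H Ht. Qed.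

Lemma ev_from V c s s0 t s' : ev V c s0 t s' -> s = s0 -> ev V c s t s'.
Proof. by move=> H ->. Qed.

Lemma state_eq v v' M i i' o o' : v = v' -> i = i' -> o = o' ->
  State v M i o = State v' M i' o'.
Proof. by move=> -> -> ->. Qed.

Lemma cons_eq (x y : nat) s t : x = y -> s = t -> x :: s = y :: t.
Proof. by move=> -> ->. Qed.

(** [op] executes the first instruction of a sequence symbolically, leaving its side condition to
    [lia]; [vars_eq] matches the variables one by one. *)
Ltac op := eapply ev_seq; [apply: ev_op; cbn; lia|cbn].
Ltac op_last := apply: ev_op; cbn; lia.
Ltac vars_eq := repeat (apply: cons_eq; [by [] || lia|]); reflexivity.

Notation regs n m x p cnt a b u g mk bs :=
  [:: 0; 1; n; n + n; 18; 18 + (n + n) + (n + n); m; x; p; cnt; a; b; u; g; mk; bs].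

Lemma print_range_ev V n m cnt x p a b u g mk bs M i o : x + cnt <= V ->
  ev V print_range (State (regs n m x p cnt a b u g mk bs) M i o) (6 * cnt + 1)
    (State (regs n m (x + cnt) p 0 a b u g mk bs) M i
       (o ++ items (fun y => [:: y]) (iota x cnt))).
Proof.
elim: cnt x o => [|cnt IH] x o Hx.
  eapply ev_to; first by apply: ev_loop0; [apply: ev_skip|].
    lia.
  by apply: state_eq; rewrite ?cats0 //; vars_eq.
eapply ev_to; first (eapply ev_loop1; [apply: ev_skip|by []| |]).
- op; op; op; op_last.
- cbn; eapply ev_from; first eapply (IH x.+1); first lia.
  apply: state_eq => //; vars_eq.
- lia.
- apply: state_eq => //; first vars_eq.
  by rewrite -!cats1 -!catA.
Qed.

Lemma clear_table_ev V n m cnt x p a b u g mk bs M i o :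
  nvars <= p -> p + cnt <= V ->
  ev V clear_table (State (regs n m x p cnt a b u g mk bs) M i o) (5 * cnt + 1)
    (State (regs n m x (p + cnt) 0 a b u g mk bs) (write_mem M p (nseq cnt 0)) i o).
Proof.
elim: cnt p M => [|cnt IH] p M Hp Hx.
  eapply ev_to; first by apply: ev_loop0; [apply: ev_skip|].
    lia.
  by apply: state_eq; rewrite ?cats0 //; vars_eq.
eapply ev_to; first (eapply ev_loop1; [apply: ev_skip|by []| |]).
- op; op; op_last.
- cbn; eapply ev_from; first eapply (IH p.+1); try lia.
  apply: state_eq => //; vars_eq.
- lia.
- apply: state_eq => //; vars_eq.
Qed.

Lemma read_evaluation_ev V n m vs x p b u g mk bs M i o :
  nvars <= x -> x + (size vs).*2 <= V ->
  ev V read_evaluation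
    (State (regs n m x p (size vs) 0 b u g mk bs) M (map nat_of_bool vs ++ i) o)
    (11 * size vs + 1)
    (State (regs n m (x + (size vs).*2) p 0 0 b u g mk bs)
       (mark_mem M (bit_codes x vs)) i
       (o ++ items (fun y => [:: y]) (bit_codes x vs))).
Proof.
elim: vs x M o => [|c vs IH] x M o Hx Hs.
  eapply ev_to; first by apply: ev_loop0; [apply: ev_skip|].
    by [].
  by apply: state_eq; rewrite ?cats0 //=; vars_eq.
have Hc : c <= 1 by case: (c).
rewrite /= in Hs.
eapply ev_to; first (eapply ev_loop1; [apply: ev_skip|by []| |]).
- do 8 op; op_last.
- cbn; eapply ev_from; first eapply (IH x.+2); try lia.
  apply: state_eq => //; vars_eq.
- cbn; lia.
- apply: state_eq => //; first by cbn; vars_eq.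
  by rewrite -!cats1 -!catA.
Qed.

(** The table holds the indicator of [E], so adding its cells counts true literals.
    [last b (map M c)] is the cell loaded last. *)
Lemma count_true_ev V n m (E c : seq nat) x p cnt a b u g mk bs (M : nat -> nat) i o :
  nvars <= p -> p + (size c).+1 <= V -> a + size c <= V ->
  all (leq nvars) c -> {in c, forall y, M y = nat_of_bool (y \in E)} ->
  holds M p (rcons c 0) ->
  ev V count_true (State (regs n m x p cnt a b u g mk bs) M i o)
    (6 * size c + 3)
    (State (regs n m x (p + (size c).+1) cnt (a + count (mem E) c)
              (last b (map M c)) 0 g mk bs) M i o).
Proof.
elim: c p a b u => [|y c IH] p a b u Hp HpV HaV Hc HE Hh.
  have M0 : M p = 0 by have := Hh 0 isT; rewrite addn0.
  eapply ev_to; first (eapply ev_loop0; first by op; op_last).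
  - by cbn.
  - by [].
  - by cbn; rewrite M0; apply: state_eq => //; vars_eq.
move: Hc => /= /andP[Hy Hc]; rewrite /= in HpV HaV.
have Mp : M p = y by have := Hh 0 isT; rewrite addn0.
have My : M y = (y \in E) by apply: HE; rewrite mem_head.
have HyE : (y \in E) <= 1 by case: (_ \in _).
eapply ev_to; first (eapply ev_loop1; [by op; op_last| | |]).
- by cbn; rewrite Mp; apply: leq_trans Hy.
- by cbn; rewrite Mp; op; apply: ev_op; cbn; lia.
- cbn; rewrite My; eapply ev_from; first eapply (IH p.+1 (a + (y \in E)) (y \in E) y) => //; try lia.
  + by move=> z Hz; apply: HE; rewrite in_cons Hz orbT.
  + by move=> j Hj; rewrite addSnnS (Hh j.+1).
  + by rewrite addn1.
- by rewrite /=; lia.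
- apply: state_eq => //=; rewrite My; vars_eq.
Qed.

Lemma clauses_code_cons c cs :
  clauses_code (c :: cs) = rcons c 0 ++ clauses_code cs.
Proof. by []. Qed.

Lemma size_clauses_code_cons c cs :
  size (clauses_code (c :: cs)) = (size c).+1 + size (clauses_code cs).
Proof. by rewrite clauses_code_cons size_cat size_rcons. Qed.

Lemma size_clauses_code cs : size cs <= size (clauses_code cs).
Proof. by elim: cs => // c cs IH; rewrite size_clauses_code_cons /=; lia. Qed.

Lemma print_unsat_ev V n m (E : seq nat) (cs : seq (seq nat)) x p
    g mk bs (M : nat -> nat) i o :
  nvars <= p -> p + size (clauses_code cs) <= V -> x + size cs <= V ->
  {in cs, forall c, all (leq nvars) c} ->
  {in cs, forall c, {in c, forall y, M y = nat_of_bool (y \in E)}} ->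
  holds M p (clauses_code cs) ->
  ev V print_unsat (State (regs n m x p (size cs) 0 0 0 g mk bs) M i o)
    (13 * size (clauses_code cs) + 1)
    (State (regs n m (x + size cs) (p + size (clauses_code cs)) 0 0 0 0 g mk bs) M i
       (o ++ items (fun y => [:: y]) (unsat E x cs))).
Proof.
elim: cs x p o => [|c cs IH] x p o Hp HpV Hx Hc HE Hh.
  eapply ev_to; first by apply: ev_loop0; [apply: ev_skip|].
    by [].
  by apply: state_eq; rewrite ?cats0 //=; vars_eq.
have [Hh1 Hh2] := holds_cat Hh.
rewrite size_clauses_code_cons /= in HpV Hx *; rewrite size_rcons in Hh2.
have Hcnt := count_size (mem E) c.
eapply ev_to; first (eapply ev_loop1; [apply: ev_skip|by []| |]).
- eapply ev_seq.
    apply: (@count_true_ev V n m E c); try lia.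
    + by apply: Hc; rewrite mem_head.
    + by apply: HE; rewrite mem_head.
    + exact: Hh1.
  op.
  (* The state is given explicitly so that both branches of the test end in it; 3 steps cover the
     longer one, which prints. *)
  eapply (@ev_seq _ _ _ _ 3
    (State (regs n m x (p + (size c).+1) (size cs).+1 (1 - count (mem E) c)
       (last 0 (map M c)) 0 g mk bs) M i
       (o ++ if has (mem E) c then [::] else [:: 1; x]))).
  + rewrite has_count add0n; case: (posnP (count (mem E) c)) => H.
    * rewrite H; apply: ev_if1; first by [].
      eapply ev_to; first by op; op_last.
        by [].
      by cbn; rewrite -!cats1 -catA.
    * have H1 : 1 - count (mem E) c = 0 by lia.
      eapply ev_to; first by apply: ev_if0; exact: H1.
        by [].
      by rewrite cats0.
  + cbn; do 3 op; op_last.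
- cbn; eapply ev_from.
  + eapply (IH x.+1 (p + (size c).+1)); try lia.
    * by move=> d Hd; apply: Hc; rewrite in_cons Hd orbT.
    * by move=> d Hd; apply: HE; rewrite in_cons Hd orbT.
    * exact: Hh2.
  + apply: state_eq => //; vars_eq.
- lia.
- apply: state_eq => //; first vars_eq.
  by case: ifP => _; rewrite -catA.
Qed.

Lemma read_literals_ev V n (c : seq (literal n)) m x p g mk bs M i o :
  nvars <= p -> p + size c <= V -> 18 + (n + n) + (n + n) <= V ->
  ev V (Loop (Op (IRead rU)) rU read_literal)
    (State (regs n m x p 0 0 0 0 g mk bs) M (encode_seq (@encode_literal n) c ++ i) o)
    (15 * size c + 2)
    (State (regs n m x (p + size c) 0 0 0 0 g mk bs)
       (write_mem M p (map (@literal_code n) c)) i o).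
Proof.
(* After a literal, [rU] holds its tag 1, so the induction needs an arbitrary initial [u]. *)
suff H u : nvars <= p -> p + size c <= V -> 18 + (n + n) + (n + n) <= V ->
  ev V (Loop (Op (IRead rU)) rU read_literal)
    (State (regs n m x p 0 0 0 u g mk bs) M (encode_seq (@encode_literal n) c ++ i) o)
    (15 * size c + 2)
    (State (regs n m x (p + size c) 0 0 0 0 g mk bs)
       (write_mem M p (map (@literal_code n) c)) i o) by apply: H.
elim: c p M u => [|l c IH] p M u Hp HpV HV.
  eapply ev_to; first by (apply: ev_loop0; first (by op_last)).
    by [].
  by apply: state_eq => //=; vars_eq.
have Hb : l.2 <= 1 by case: (l.2).
have Hi : (match l.1 with inl j => nat_of_ord j | inr j => nat_of_ord j end) < n by case: (l.1).
rewrite /= in HpV.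
eapply ev_to; first (eapply ev_loop1; [by op_last|by []| |]).
(* A common final state for x- and y-literals; the latter take 12 steps, one more than the
   former. *)
- instantiate (1 := State (regs n m x p.+1 0 0 0 1 g mk bs)
    (set_reg M p (literal_code l)) (encode_seq (@encode_literal n) c ++ i) o).
  instantiate (1 := 12).
  case: l Hb Hi => [[j|j] b] /= Hb Hi; cbn in Hb, Hi.
  + eapply ev_to.
    * do 4 op; eapply ev_seq; first by apply: ev_if0.
      cbn; do 5 op; op_last.
    * by [].
    * cbn; rewrite /literal_code /= addn1; by [].
  + eapply ev_to.
    * do 4 op; eapply ev_seq; first (apply: ev_if1; first by []; by op_last).
      cbn; do 5 op; op_last.
    * by [].
    * cbn; rewrite /literal_code /= addn1; by [].
- eapply (IH p.+1); lia.
- rewrite /=; lia.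
- apply: state_eq => //=; vars_eq.
Qed.

Lemma read_clauses_ev V n (cs : seq (clause n)) m x p g mk bs M i o :
  let L := clauses_code [seq map (@literal_code n) c | c <- cs] in
  nvars <= p -> p + size L <= V -> 18 + (n + n) + (n + n) <= V ->
  x + size cs <= V -> m + size cs <= V ->
  ev V (Loop (Op (IRead rG)) rG read_clause)
    (State (regs n m x p 0 0 0 0 g mk bs) M
       (encode_seq (encode_seq (@encode_literal n)) cs ++ i) o)
    (15 * size L + 2)
    (State (regs n (m + size cs) (x + size cs) (p + size L) 0 0 0 0 0 mk bs)
       (write_mem M p L) i (o ++ items (fun y => [:: y]) (iota x (size cs)))).
Proof.
elim: cs m x p M g o => [|c cs IH] m x p M g o; cbv zeta => Hp HpV HV Hx Hm.
  eapply ev_to; first by (apply: ev_loop0; first (by op_last)).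
    by [].
  by apply: state_eq => //=; [vars_eq|rewrite cats0].
rewrite [map _ _]/= in HpV *; rewrite /= in Hx Hm.
rewrite size_clauses_code_cons size_map in HpV *.
eapply ev_to; first (eapply ev_loop1; [by op_last|by []| |]).
- cbn; rewrite -catA; do 4 op; eapply ev_seq; first (apply: read_literals_ev => //; lia).
  op; op_last.
- cbn; eapply ev_from; first (eapply (IH m.+1 x.+1 (p + size c + 1)); lia).
  apply: state_eq => //; vars_eq.
- cbn; lia.
- rewrite clauses_code_cons write_mem_cat size_rcons -(cats1 (map _ c)) write_mem_cat size_map addn1 addnS.
  apply: state_eq => //; first (rewrite [size (c :: cs)]/=; vars_eq).
  by rewrite -!cats1 -!catA.
Qed.

Definition set_list (n mk base : nat) (cs : seq (seq nat)) (bs : seq bool) :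
    seq nat :=
  mk :: bit_codes base bs ++ unsat (bit_codes base bs) (18 + (n + n) + (n + n)) cs.

Notation sets_regs n cs g mk base :=
  (regs n (size cs) (18 + (n + n) + (n + n) + size cs)
     (18 + (n + n) + (n + n) + size (clauses_code cs)) 0 0 0 0 g mk base).

(** The table remains marked on exit, so the final memory is known only through the stored clauses;
    the next set starts by clearing the table. *)
Lemma print_set_ev V n (cs : seq (seq nat)) g mk base bs M i o :
  size bs = n -> 18 <= base -> base + (n + n) <= 18 + (n + n) + (n + n) ->
  18 + (n + n) + (n + n) + size (clauses_code cs) <= V ->
  {in cs, forall c, {in c, forall y, 18 <= y < 18 + (n + n) + (n + n)}} ->
  holds M (18 + (n + n) + (n + n)) (clauses_code cs) ->
  exists M', holds M' (18 + (n + n) + (n + n)) (clauses_code cs) /\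
  ev V print_set (State (sets_regs n cs g mk base) M (map nat_of_bool bs ++ i) o)
    (31 * V)
    (State (sets_regs n cs g mk base) M' i
       (o ++ 1 :: encode_set (set_list n mk base cs bs))).
Proof.
move=> Hbs Hb1 Hb2 HV Hcs Hh.
set CS := 18 + (n + n) + (n + n) in Hb2 HV Hcs Hh *.
have HCS : CS = 18 + (n + n) + (n + n) by [].
pose E := bit_codes base bs.
pose M' := mark_mem (write_mem M 18 (nseq (CS - 18) 0)) E.
have HE a : a \in E -> 18 <= a < CS.
  by move=> /bit_codes_range; rewrite Hbs; lia.
(* Cleared and then marked, the table is the indicator of [E]; the clauses lie beyond it and
   survive. *)
have Htab a : 18 <= a < CS -> M' a = (a \in E).
  move=> Ha; rewrite /M' mark_memE; case: (a \in E) => //.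
  by rewrite write_memE size_nseq nth_nseq; case: ifP => [_|]; [case: ifP|lia].
have Hclau a : CS <= a -> M' a = M a.
  move=> Ha; rewrite /M' mark_memE; case: ifP => [/HE|_]; first lia.
  by rewrite write_memE size_nseq; case: ifP => //; lia.
have Hh' : holds M' CS (clauses_code cs).
  by move=> j Hj; rewrite Hclau ?leq_addr // Hh.
have HL := size_clauses_code cs.
have Henc : encode_set (set_list n mk base cs bs)
    = [:: 1; mk] ++ items (fun y => [:: y]) E
      ++ items (fun y => [:: y]) (unsat E CS cs) ++ [:: 0].
  by rewrite /encode_set encode_seqE /set_list -[mk :: _]cat1s !items_cat -!catA.
exists M'; split=> //.
eapply ev_to.
- do 5 op; rewrite -/CS.
  eapply ev_seq; first (apply: clear_table_ev => //; lia).
  do 2 op; rewrite -/CS.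
  eapply ev_seq.
    eapply ev_from; first (eapply (@read_evaluation_ev V n (size cs) bs base); rewrite ?Hbs /nvars; lia).
    rewrite !addn0 Hbs; apply: state_eq => //; vars_eq.
  rewrite ?addn0; do 3 op; rewrite -/CS.
  eapply ev_seq.
    eapply ev_from; first (eapply (@print_unsat_ev V n (size cs) E cs CS CS g mk base M')).
    + rewrite /nvars; lia.
    + lia.
    + lia.
    + by move=> c Hc; apply/allP=> y /(Hcs c Hc); rewrite /nvars; lia.
    + by move=> c Hc y /(Hcs c Hc); apply: Htab.
    + exact: Hh'.
    + rewrite /M' /E ?addn0; apply: state_eq => //; vars_eq.
  op_last.
- lia.
- rewrite Henc; apply: state_eq => //.
  by rewrite -!cats1 -!catA.
Qed.

Lemma print_sets_ev V n (cs : seq (seq nat)) (evs : seq (evaluation n)) g mk base M i o :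
  18 <= base -> base + (n + n) <= 18 + (n + n) + (n + n) ->
  18 + (n + n) + (n + n) + size (clauses_code cs) <= V ->
  {in cs, forall c, {in c, forall y, 18 <= y < 18 + (n + n) + (n + n)}} ->
  holds M (18 + (n + n) + (n + n)) (clauses_code cs) ->
  exists M', holds M' (18 + (n + n) + (n + n)) (clauses_code cs) /\
  ev V print_sets
    (State (sets_regs n cs g mk base) M (encode_seq (@encode_evaluation n) evs ++ i) o)
    ((31 * V + 3) * size evs + 2)
    (State (sets_regs n cs 0 mk base) M' i
       (o ++ items encode_set [seq set_list n mk base cs v | v : evaluation n <- evs])).
Proof.
move=> Hb1 Hb2 HV Hcs.
elim: evs g M o => [|v evs IH] g M o Hh.
  exists M; split=> //.
  eapply ev_to; first by (apply: ev_loop0; first (by op_last)).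
    by rewrite muln0.
  by apply: state_eq => //=; rewrite ?cats0; vars_eq.
have [M1 [H1 E1]] := print_set_ev 1 mk (encode_seq (@encode_evaluation n) evs ++ i) o
  (size_tuple v) Hb1 Hb2 HV Hcs Hh.
have [M2 [H2 E2]] := IH 1 M1 (o ++ 1 :: encode_set (set_list n mk base cs v)) H1.
exists M2; split=> //.
eapply ev_to; first (eapply ev_loop1; [by op_last|by []| |exact: E2]).
- by eapply ev_from; [exact: E1|]; cbn; rewrite -catA.
- by rewrite /= mulnS; lia.
- by rewrite -catA.
Qed.

Lemma reduction_cmd_ev V n (cs : seq (clause n)) (xs ys : seq (evaluation n)) :
  let cc := [seq map (@literal_code n) c | c <- cs] in
  let L := clauses_code cc in
  let ground := iota 16 (2 + (n + n) + (n + n) + size cs) in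
  18 + (n + n) + (n + n) + size L <= V ->
  exists s, ev V reduction_cmd
    (State (nseq nvars 0) (fun=> 0)
       (n :: encode_seq (encode_seq (@encode_literal n)) cs
         ++ encode_seq (@encode_evaluation n) xs
         ++ encode_seq (@encode_evaluation n) ys) [::])
    ((31 * V + 3) * (size xs + size ys) + 28 * V + 30) s /\
  sout s = encode_set ground ++ encode_seq encode_set
    ([seq set_list n 16 18 cc v | v : evaluation n <- xs]
     ++ [seq set_list n 17 (18 + (n + n)) cc v | v : evaluation n <- ys]
     ++ [:: ground]).
Proof.
move=> cc L ground HV.
set CS := 18 + (n + n) + (n + n) in HV *.
have HCS : CS = 18 + (n + n) + (n + n) by [].
have Hsz : size cc = size cs by rewrite size_map.
have HL : size cs <= size L by rewrite -Hsz size_clauses_code.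
have Hcc : {in cc, forall c, {in c, forall y, 18 <= y < 18 + (n + n) + (n + n)}}.
  by move=> c /mapP[d _ ->] y /mapP[l _ ->]; apply: literal_code_range.
pose M1 := write_mem (fun=> 0) CS L.
have HM1 : holds M1 CS L by apply: holds_write_mem.
pose i2 := encode_seq (@encode_evaluation n) ys.
pose o1 := encode_set ground.
have [|||M2 [HM2 E2]] := @print_sets_ev V n cc xs 0 16 18 M1 i2 o1 _ _ _ Hcc HM1.
- by [].
- by rewrite -/CS; lia.
- exact: HV.
set o2 := o1 ++ _ in E2.
have [|||M3 [HM3 E3]] := @print_sets_ev V n cc ys 0 17 (18 + (n + n)) M2 [::] o2 _ _ _ Hcc HM2.
- by lia.
- by rewrite -/CS; lia.
- exact: HV.
set o3 := o2 ++ _ in E3.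
eexists; split.
eapply ev_weak.
- do 8 op; rewrite -/CS.
  eapply ev_seq; first (apply: print_range_ev; lia).
  op.
  eapply ev_seq; first (apply: read_clauses_ev; rewrite -/cc -/L /nvars; lia).
  rewrite -/cc -/L.
  do 3 op.
  eapply ev_seq.
    eapply ev_from; first exact: E2.
    rewrite addn0 -/CS Hsz; apply: state_eq; [by vars_eq|by []|].
    (* The ground list was printed in two pieces, markers and literals first, then the clause names;
       the two intervals are consecutive. *)
    rewrite /o1 /encode_set encode_seqE -cats1 -items_cat.
    congr (items _ _ ++ _).
    rewrite /ground (_ : 2 + (n + n) + (n + n) = CS - 16); last by lia.
    by rewrite iotaD; congr (iota _ _ ++ iota _ _); lia.
  do 2 op.
  eapply ev_seq.
    eapply ev_from; first exact: E3.
    apply: state_eq; [by vars_eq|by rewrite cats0|by []].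
  do 4 op.
  eapply ev_seq; first (apply: print_range_ev; rewrite -/CS; lia).
  op; op_last.
- rewrite -/cc -/L -/CS Hsz mulnDr.
  set q1 := (_ * size xs); set q2 := (_ * size ys); lia.
have Hg : ground = iota 16 (CS + size cc - 16) by rewrite Hsz; congr iota; lia.
transitivity (rcons (rcons (rcons o3 1 ++ items (fun y => [:: y]) ground) 0) 0).
  by rewrite Hg.
rewrite encode_seqE !items_cat /o3 /o2 /o1; move: (ground) => gr.
rewrite -!cats1 -!catA; do 3 congr (_ ++ _).
by rewrite /encode_set encode_seqE /= -catA.
Qed.

(** * Correctness of the reduction *)

Lemma mem_bit_codes q bs a :
  reflect (exists2 i, i < size bs & a = q + i.*2 + nth false bs i)
    (a \in bit_codes q bs).
Proof.
elim: bs q => [|b bs IH] q /=; first by right=> -[].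
rewrite in_cons; apply: (iffP orP) => [[/eqP->|/IH[i Hi E]]|[[|i] Hi E]].
- by exists 0 => //=; rewrite addn0.
- by exists i.+1 => //=; lia.
- by left; rewrite E addn0.
- by right; apply/IH; exists i => //; rewrite E /=; lia.
Qed.

Lemma bit_codes_uniq q bs : uniq (bit_codes q bs).
Proof.
elim: bs q => //= b bs IH q; rewrite IH andbT.
by apply/negP => /bit_codes_range; case: b; lia.
Qed.

Lemma unsat_subseq E x cs : subseq (unsat E x cs) (iota x (size cs)).
Proof.
elim: cs x => //= c cs IH x; case: ifP => _; last by rewrite /= eqxx.
by apply: subseq_trans (IH _) (subseq_cons _ _).
Qed.

Lemma unsat_range E x cs a : a \in unsat E x cs -> x <= a < x + size cs.
Proof. by move=> /(mem_subseq (unsat_subseq _ _ _)); rewrite mem_iota. Qed.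

Lemma mem_unsat E x cs j :
  (x + j \in unsat E x cs) = (j < size cs) && ~~ has (mem E) (nth [::] cs j).
Proof.
elim: cs x j => [|c cs IH] x [|j] //=.
  rewrite addn0; case: ifP => _ /=; last by rewrite mem_head.
  by apply/negP => /unsat_range; rewrite ltnn.
rewrite ltnS -(IH x.+1) addSnnS; case: ifP => _ //.
by rewrite in_cons (_ : _ == x = false) //; apply/eqP; lia.
Qed.

(** The x-codes and y-codes fill disjoint intervals, so a code determines its side; its offset there
    gives the variable by halving and the value by parity. *)
Lemma literal_trueE n (v w : evaluation n) (l : literal n) :
  literal_true v w l = (literal_code l \in bit_codes 18 v)
                       || (literal_code l \in bit_codes (18 + (n + n)) w).
Proof.
have sz (u : evaluation n) : size u = n by apply: size_tuple.
case: l => [[i|i] b]; rewrite /literal_true /literal_code /=; have Hi := ltn_ord i.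
- rewrite (tnth_nth false); apply/eqP/orP => [Hb|[/mem_bit_codes[j Hj E]|/bit_codes_range]].
  + by left; apply/mem_bit_codes; exists i; rewrite ?sz // Hb; lia.
  (* For bits [b] and [b'], equality of [2i + b] and [2j + b'] forces [i = j]. *)
  + have : nat_of_ord i = j by case: (b) (nth _ _ _) E => -[]; lia.
    by move=> Eij; move: E; rewrite -Eij; case: b (nth _ _ _) => -[]; lia.
  + by case: (b); lia.
- rewrite (tnth_nth false); apply/eqP/orP => [Hb|[/bit_codes_range|/mem_bit_codes[j Hj E]]].
  + by right; apply/mem_bit_codes; exists i; rewrite ?sz // Hb; lia.
  + by rewrite sz; case: (b); lia.
  + have : nat_of_ord i = j by case: (b) (nth _ _ _) E => -[]; lia.
    by move=> Eij; move: E; rewrite -Eij; case: b (nth _ _ _) => -[]; lia.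
Qed.

Lemma clause_trueE n (v w : evaluation n) (c : clause n) :
  clause_true v w c =
    has (mem (bit_codes 18 v)) (map (@literal_code n) c)
    || has (mem (bit_codes (18 + (n + n)) w)) (map (@literal_code n) c).
Proof.
rewrite /clause_true !has_map -has_predU; apply: eq_has => l /=.
exact: literal_trueE.
Qed.

Lemma in_set_list n mk base cs bs a :
  (a \in set_list n mk base cs bs) =
    [|| a == mk, a \in bit_codes base bs
      | a \in unsat (bit_codes base bs) (18 + (n + n) + (n + n)) cs].
Proof. by rewrite in_cons mem_cat. Qed.

(** The marker, the literals and the clause names lie in disjoint intervals: below 18, from 18 to
    [17 + 4n], and from [18 + 4n] on. *)
Lemma set_list_uniq n mk base cs (bs : evaluation n) :
  mk < 18 -> 18 <= base -> base <= 18 + (n + n) ->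
  uniq (set_list n mk base cs bs).
Proof.
move=> Hmk Hb1 Hb2; rewrite /= cat_uniq bit_codes_uniq /=.
rewrite (subseq_uniq (unsat_subseq _ _ _)) ?iota_uniq // andbT.
have sz : size bs = n by apply: size_tuple.
apply/andP; split.
  by rewrite mem_cat; apply/negP => /orP[/bit_codes_range|/unsat_range]; lia.
apply/hasPn => a /unsat_range Ha; apply/negP => /bit_codes_range; lia.
Qed.

Lemma set_list_sub n mk base cs (bs : evaluation n) a :
  16 <= mk < 18 -> 18 <= base -> base <= 18 + (n + n) ->
  a \in set_list n mk base cs bs ->
  a \in iota 16 (2 + (n + n) + (n + n) + size cs).
Proof.
move=> Hmk Hb1 Hb2; have sz : size bs = n by apply: size_tuple.
rewrite in_set_list mem_iota => /or3P[/eqP->|/bit_codes_range|/unsat_range]; lia.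
Qed.

(** The element recording variable [i] under [v] lies between the markers and the clause names, so
    in the set of [w] it also records a value; parity shows that variable and value agree. *)
Lemma set_list_inj n mk base cs (v w : evaluation n) :
  mk < 18 -> 18 <= base -> base <= 18 + (n + n) ->
  perm_eq (set_list n mk base cs v) (set_list n mk base cs w) -> v = w.
Proof.
move=> Hmk Hb1 Hb2 /perm_mem H; apply: eq_from_tnth => i.
have sz (u : evaluation n) : size u = n by apply: size_tuple.
have Hi := ltn_ord i.
have /mem_bit_codes[j Hj] : base + i.*2 + tnth v i \in bit_codes base w.
  have := H (base + i.*2 + tnth v i); rewrite !in_set_list.
  have -> : base + i.*2 + tnth v i \in bit_codes base v.
    by apply/mem_bit_codes; exists i; rewrite ?sz // (tnth_nth false).
  rewrite orbT => /esym/or3P[/eqP|//|/unsat_range]; first lia.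
  by case: (tnth v i); lia.
rewrite (tnth_nth false w) => E.
have Eij : nat_of_ord i = j by case: (tnth v i) (nth _ _ _) E => -[]; lia.
by move: E; rewrite -Eij; case: (tnth v i) (nth _ _ _) => -[]; lia.
Qed.

(** * The collection of sets and its answer *)

Definition set_ground (k : nat) (I : sat_star k) : seq nat :=
  iota 16 (2 + (nvar I + nvar I) + (nvar I + nvar I) + size (clauses I)).

Definition coded_clauses (k : nat) (I : sat_star k) : seq (seq nat) :=
  [seq map (@literal_code _) c | c <- clauses I].

Definition xset (k : nat) (I : sat_star k) (v : evaluation (nvar I)) : seq nat :=
  set_list (nvar I) 16 18 (coded_clauses I) v.

Definition yset (k : nat) (I : sat_star k) (v : evaluation (nvar I)) : seq nat :=
  set_list (nvar I) 17 (18 + (nvar I + nvar I)) (coded_clauses I) v.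

Arguments xset {k} I v.
Arguments yset {k} I v.

Definition set_coll (k : nat) (I : sat_star k) : seq (seq nat) :=
  map (xset I) (xevals I) ++ map (yset I) (yevals I) ++ [:: set_ground I].

Lemma xset_sub k (I : sat_star k) v : {subset xset I v <= set_ground I}.
Proof.
move=> a /set_list_sub; rewrite size_map; apply=> //; exact: leq_addr.
Qed.

Lemma yset_sub k (I : sat_star k) v : {subset yset I v <= set_ground I}.
Proof.
move=> a /set_list_sub; rewrite size_map; apply=> //; exact: leq_addr.
Qed.

Lemma xset_marker k (I : sat_star k) v : 17 \notin xset I v.
Proof.
by rewrite in_set_list; apply/negP => /or3P[//|/bit_codes_range|/unsat_range]; lia.
Qed.

Lemma yset_marker k (I : sat_star k) v : 16 \notin yset I v.
Proof.
by rewrite in_set_list; apply/negP => /or3P[//|/bit_codes_range|/unsat_range]; lia.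
Qed.

Lemma set_coll_mem k (I : sat_star k) S : S \in set_coll I ->
  [\/ exists v, S = xset I v, exists v, S = yset I v | S = set_ground I].
Proof.
rewrite !mem_cat mem_seq1 => /or3P[/mapP[v _ ->]|/mapP[v _ ->]|/eqP->].
- by constructor 1; exists v.
- by constructor 2; exists v.
- by constructor 3.
Qed.

Lemma xset_coll k (I : sat_star k) v : xset I v \in set_coll I.
Proof. by rewrite mem_cat map_f // (perm_mem (xevals_all I)) mem_enum. Qed.

Lemma yset_coll k (I : sat_star k) v : yset I v \in set_coll I.
Proof.
rewrite !mem_cat [X in [|| _, X | _]]map_f ?orbT //.
by rewrite (perm_mem (yevals_all I)) mem_enum.
Qed.

Lemma set_coll_sets k (I : sat_star k) : all uniq (set_coll I).
Proof.
apply/allP => S /set_coll_mem[[v ->]|[v ->]|->].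
- by apply: set_list_uniq => //; apply: leq_addr.
- by apply: set_list_uniq => //; apply: leq_addr.
- exact: iota_uniq.
Qed.

Lemma set_coll_sub k (I : sat_star k) :
  all (fun S => all (mem (set_ground I)) S) (set_coll I).
Proof.
apply/allP => S /set_coll_mem[[v ->]|[v ->]|->]; apply/allP => a //=.
- exact: xset_sub.
- exact: yset_sub.
Qed.

Lemma pairwise_map_inj (T : eqType) (f : T -> seq nat) s :
  (forall v w, perm_eq (f v) (f w) -> v = w) -> uniq s ->
  pairwise (fun S S' => ~~ perm_eq S S') (map f s).
Proof.
move=> Hf; rewrite pairwise_map uniq_pairwise; apply: sub_pairwise => v w /=.
by apply: contra => /Hf ->.
Qed.

(** The x-sets contain 16 but not 17, the y-sets 17 but not 16, and the ground set both; within one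
    side the recorded assignment tells the sets apart. *)
Lemma set_coll_distinct k (I : sat_star k) :
  pairwise (fun S T => ~~ perm_eq S T) (set_coll I).
Proof.
have ux : uniq (xevals I) by rewrite (perm_uniq (xevals_all I)) enum_uniq.
have uy : uniq (yevals I) by rewrite (perm_uniq (yevals_all I)) enum_uniq.
have g16 : 16 \in set_ground I by rewrite mem_iota.
have g17 : 17 \in set_ground I by rewrite mem_iota.
rewrite !pairwise_cat /= andbT; apply/and4P; split.
- rewrite allrel_catr; apply/andP; split; apply/allrelP => S T /mapP[v _ ->].
    move=> /mapP[w _ ->]; apply/negP => /perm_mem/(_ 16).
    by rewrite mem_head (negbTE (yset_marker w)).
  rewrite mem_seq1 => /eqP->; apply/negP => /perm_mem/(_ 17).
  by rewrite g17 (negbTE (xset_marker v)).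
- by apply: pairwise_map_inj ux => v w; apply: set_list_inj => //; apply: leq_addr.
- apply/allrelP => S T /mapP[v _ ->].
  rewrite mem_seq1 => /eqP->; apply/negP => /perm_mem/(_ 16).
  by rewrite g16 (negbTE (yset_marker v)).
- by apply: pairwise_map_inj uy => v w; apply: set_list_inj => //; apply: leq_addr.
Qed.

(** The markers differ and the literal codes of the two sides are disjoint, so a common element
    names a clause that neither [v] nor [w] satisfies. *)
Lemma xset_yset_disjoint k (I : sat_star k) v w :
  has (mem (xset I v)) (yset I w) = ~~ all (clause_true v w) (clauses I).
Proof.
have sz (u : evaluation (nvar I)) : size u = nvar I by apply: size_tuple.
apply/hasP/allPn => [[a]|[c Hc]].
  rewrite in_set_list /= => /or3P[/eqP->|/bit_codes_range Ha|Ha].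
  - by rewrite (negbTE (xset_marker v)).
  - rewrite sz in Ha; rewrite in_set_list => /or3P[/eqP|/bit_codes_range|/unsat_range]; rewrite ?sz; lia.
  - have Hr := unsat_range Ha.
    rewrite in_set_list => /or3P[/eqP|/bit_codes_range|]; rewrite ?sz; [lia|lia|].
    move: Ha; rewrite -(subnKC (proj1 (andP Hr))) !mem_unsat.
    set j := _ - _; move=> /andP[Hj Hw] /andP[_ Hv].
    rewrite size_map in Hj.
    exists (nth [::] (clauses I) j); first exact: mem_nth.
    by rewrite clause_trueE negb_or; rewrite (nth_map [::]) // in Hw Hv; rewrite Hv Hw.
rewrite clause_trueE negb_or => /andP[Hv Hw].
have Hj : index c (clauses I) < size (clauses I) by rewrite index_mem.
exists (18 + (nvar I + nvar I) + (nvar I + nvar I) + index c (clauses I)).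
  by rewrite in_set_list mem_unsat size_map Hj (nth_map [::]) // nth_index // Hw !orbT.
by rewrite /= in_set_list mem_unsat size_map Hj (nth_map [::]) // nth_index // Hv !orbT.
Qed.

(** Two sets of the same side share their marker and the ground set meets every member, so a
    disjoint pair consists of an x-set and a y-set, in either order. *)
Lemma set_coll_answer k (I : sat_star k) :
  sat_star_answer I <->
  exists S T, [/\ S \in set_coll I, T \in set_coll I, S != T & ~~ has (mem S) T].
Proof.
have Hg S : S \in set_coll I -> has (mem (set_ground I)) S.
  case/set_coll_mem=> [[v ->]|[v ->]|->]; apply/hasP.
  - by exists 16; rewrite ?mem_head // /= mem_iota.
  - by exists 17; rewrite ?mem_head // /= mem_iota.
  - by exists 16; rewrite /= mem_iota.
have Hx (v v' : evaluation (nvar I)) : has (mem (xset I v)) (xset I v').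
  by apply/hasP; exists 16; rewrite /= mem_head.
have Hy (v v' : evaluation (nvar I)) : has (mem (yset I v)) (yset I v').
  by apply/hasP; exists 17; rewrite /= mem_head.
split=> [[v [w H]]|[S [T [HS HT _]]]].
  exists (xset I v), (yset I w); split; [exact: xset_coll|exact: yset_coll| |].
    by apply/eqP => E; have := xset_marker v; rewrite E mem_head.
  by rewrite xset_yset_disjoint H.
case/set_coll_mem: (HS) => [[v ->]|[v ->]|->]; last by rewrite Hg.
- case/set_coll_mem: (HT) => [[w ->]|[w ->]|E]; first by rewrite Hx.
    by rewrite xset_yset_disjoint negbK; exists v, w.
  by rewrite has_sym E Hg ?xset_coll.
- case/set_coll_mem: (HT) => [[w ->]|[w ->]|E]; last by rewrite has_sym E Hg ?yset_coll.
    by rewrite has_sym xset_yset_disjoint negbK; exists w, v.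
  by rewrite Hy.
Qed.

(** * Size and time bounds *)

Fixpoint short_seqs (T : Type) (s : seq T) (k : nat) : seq (seq T) :=
  if k is k'.+1 then [::] :: [seq x :: t | x <- s, t <- short_seqs s k']
  else [:: [::]].

(** With [N] the size of [s], the recursion rests on [1 + N * (N + 1)^k <= (N + 1)^(k + 1)]. *)
Lemma size_short_seqs (T : Type) (s : seq T) k :
  size (short_seqs s k) <= (size s).+1 ^ k.
Proof.
elim: k => //= k IH; rewrite size_allpairs expnS mulSn -add1n leq_add //.
  by rewrite expn_gt0.
by rewrite leq_mul2l IH orbT.
Qed.

Lemma mem_short_seqs (T : eqType) (s t : seq T) k :
  size t <= k -> {subset t <= s} -> t \in short_seqs s k.
Proof.
elim: k t => [|k IH] [|x t] //= Ht Hs; rewrite in_cons //=.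
apply/allpairsP; exists (x, t); split=> //=; first by rewrite Hs ?mem_head.
by apply: IH => // y Hy; rewrite Hs // in_cons Hy orbT.
Qed.

(** Clauses are distinct sequences of at most [k] among the [4n] literals. *)
Lemma size_clauses k (I : sat_star k) :
  size (clauses I) <= (4 * nvar I).+1 ^ k.
Proof.
pose s := enum {: ('I_(nvar I) + 'I_(nvar I)) * bool}.
have Hs : size s = 4 * nvar I.
  by rewrite -cardE card_prod card_sum !card_ord card_bool; lia.
rewrite -Hs; apply: leq_trans (size_short_seqs s k).
apply: (uniq_leq_size (clauses_uniq I)) => c Hc.
apply: mem_short_seqs => [|l _]; last by rewrite mem_enum.
exact: (allP (clauses_size I)).
Qed.

(** At most [k] literals and a final 0 are stored per clause. *)
Lemma size_coded_clauses k (I : sat_star k) :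
  size (clauses_code (coded_clauses I)) <= k.+1 * size (clauses I).
Proof.
rewrite /coded_clauses; have := clauses_size I; elim: (clauses I) => //= c cs IH.
move=> /andP[Hc /IH Hcs]; rewrite size_clauses_code_cons size_map mulnS.
by rewrite leq_add.
Qed.

Lemma size_evaluations n (s : seq (evaluation n)) :
  perm_eq s (enum {: evaluation n}) -> size s = 2 ^ n.
Proof. by move=> /perm_size ->; rewrite -cardE card_tuple card_bool. Qed.

Lemma size_bits w : size w <= bits w.
Proof. by elim: w => //= x w IH; rewrite /bits /= -add1n leq_add. Qed.

Lemma size_encode_seq (T : Type) (e : T -> seq nat) s :
  size s <= size (encode_seq e s).
Proof. by elim: s => //= a s IH; rewrite size_cat; lia. Qed.

(** Each of the [2^n] evaluations of either side contributes at least its tag. Hence [n] is at most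
    logarithmic in the input size, and factors polynomial in [n] become polylogarithmic. *)
Lemma isize_ge k (I : sat_star k) :
  2 ^ (nvar I).+1 <= @isize (SatStarProblem k) I.
Proof.
apply: leq_trans (size_bits _); rewrite /= /encode_sat_star /= !size_cat.
have := size_encode_seq (@encode_evaluation _) (xevals I).
have := size_encode_seq (@encode_evaluation _) (yevals I).
by rewrite !size_evaluations ?xevals_all ?yevals_all // expnS; lia.
Qed.

Lemma all_encode_seq (T : Type) (p : pred nat) (e : T -> seq nat) s :
  p 0 -> p 1 -> all (fun a => all p (e a)) s -> all p (encode_seq e s).
Proof.
move=> p0 p1; elim: s => [|a s IH] /=; first by rewrite p0.
by move=> /andP[Ha /IH Hs]; rewrite p1 all_cat Ha.
Qed.

Lemma encode_sat_star_le k (I : sat_star k) V :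
  0 < V -> nvar I <= V -> all (fun x => x <= V) (encode_sat_star I).
Proof.
move=> HV Hn.
have Hb (b : bool) : b <= V by case: b.
have He (s : seq (evaluation (nvar I))) :
    all (fun x => x <= V) (encode_seq (@encode_evaluation _) s).
  apply: all_encode_seq => //; apply/allP => v _.
  by apply/allP => x /mapP[b _ ->].
rewrite /encode_sat_star /= Hn !all_cat !He !andbT.
apply: all_encode_seq => //; apply/allP => c _.
apply: all_encode_seq => //; apply/allP => -[[i|i] b] _;
  by rewrite /= Hb ?HV (leq_trans (ltnW (ltn_ord i)) Hn).
Qed.

(** The first address past the stored clauses, which bounds every value of the run. *)
Definition value_bound (k : nat) (I : sat_star k) : nat :=
  18 + (nvar I + nvar I) + (nvar I + nvar I)
  + size (clauses_code (coded_clauses I)).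

Lemma reduction_run k (I : sat_star k) : exists t cf,
  [/\ run (compile 0 reduction_cmd) (init (encode_sat_star I)) t cf,
      t <= 320 * value_bound I ^ 2 * 2 ^ (nvar I).+1
    & out cf = encode_set (set_ground I) ++ encode_seq encode_set (set_coll I)].
Proof.
set V := value_bound I.
have HV : 18 <= V by rewrite /V /value_bound; lia.
have [s [E Hs]] := @reduction_cmd_ev V _ (clauses I) (xevals I) (yevals I) (leqnn _).
have [|||t [cf [Hrun Ht Ho]]] := ev_run E.
- by [].
- by rewrite /nvars; lia.
- by apply: encode_sat_star_le; rewrite ?/V /value_bound; lia.
exists t, cf; split=> //; last by rewrite Ho Hs.
apply: leq_trans Ht _; rewrite !size_evaluations ?xevals_all ?yevals_all // (expnS 2).
(* A crude bound suffices, since [V] is polynomial in [n] for fixed [k]. *)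
have Hb : bitlen V <= V.
  rewrite /bitlen; apply: leq_trans (trunc_logP (isT : 1 < 2) _); last by lia.
  exact: ltn_expl.
have H2 : 1 <= 2 ^ nvar I by rewrite expn_gt0.
(* The factor [64 * V] per evaluation also absorbs the steps outside the loops over evaluations; 64
   times 5 gives 320. *)
apply: (@leq_trans ((64 * V * (2 * 2 ^ nvar I)) * (5 * V))).
  apply: leq_mul; last by lia.
  nia.
by rewrite -mulnn; lia.
Qed.

(** As [k] is positive, the linear term is at most [18 * (n + 1)^k]; the clauses contribute through
    [(4n + 1)^k <= 4^k * (n + 1)^k]. *)
Lemma value_bound_le k (I : sat_star k) : 0 < k ->
  value_bound I <= (18 + k.+1 * 4 ^ k) * (nvar I).+1 ^ k.
Proof.
move=> Hk; set n := nvar I.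
have H1 : 18 + (n + n) + (n + n) <= 18 * n.+1 ^ k.
  apply: (@leq_trans (18 * n.+1)); first lia.
  by rewrite leq_mul2l -{1}[n.+1]expn1 leq_pexp2l.
have H2 : size (clauses_code (coded_clauses I)) <= k.+1 * 4 ^ k * n.+1 ^ k.
  apply: leq_trans (size_coded_clauses I) _.
  rewrite -mulnA leq_mul2l -expnMn /=.
  apply: leq_trans (size_clauses I) _; rewrite leq_exp2r //; lia.
by rewrite mulnDl leq_add.
Qed.

(** * Real logarithms and the size of the ground set *)

Lemma INR_expn m n : INR (m ^ n) = (INR m ^ n)%Re.
Proof. by elim: n => // n IH; rewrite expnS mult_INR IH. Qed.

Lemma INR_le m n : m <= n -> (INR m <= INR n)%Re.
Proof. by move=> H; apply: le_INR; apply/leP. Qed.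

Lemma ln_le x y : (0 < x -> x <= y -> ln x <= ln y)%Re.
Proof.
move=> Hx [H|->]; last exact: Rle_refl.
by left; apply: ln_increasing.
Qed.

Lemma ln_pow2_le n x : 2 ^ n <= x -> (INR n * ln 2 <= ln (INR x))%Re.
Proof.
move=> /INR_le H; rewrite -ln_pow; last lra.
have -> : 2%Re = INR 2 by [].
rewrite INR_expn in H.
have : (0 < INR 2 ^ n)%Re by apply: pow_lt; rewrite /=; lra.
by move=> H0; apply: ln_le.
Qed.

Lemma log2_pow2_le n x : 2 ^ n <= x -> (INR n <= log2 (INR x))%Re.
Proof.
move=> /ln_pow2_le H; have L2 := ln_lt_2; rewrite /log2.
apply: (Rmult_le_reg_r (ln 2)); first lra.
by rewrite /Rdiv Rmult_assoc Rinv_l; lra.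
Qed.

(** From [2^3 <= 3^2]. It serves instances without variables, whose collection has three sets. *)
Lemma log2_3_gt x : 3 <= x -> (3 / 2 <= log2 (INR x))%Re.
Proof.
move=> /INR_le H; have L2 := ln_lt_2.
have H3 : (3 * ln 2 <= 2 * ln (INR x))%Re.
  have -> : (3 * ln 2 = ln (2 ^ 3))%Re by rewrite ln_pow /=; lra.
  have -> : (2 * ln (INR x) = ln (INR x ^ 2))%Re.
    by rewrite ln_pow /=; [|move: H; rewrite /=; lra]; lra.
  by apply: ln_le; [lra|move: H; rewrite /=; nra].
rewrite /log2; apply: (Rmult_le_reg_r (ln 2)); first lra.
by rewrite /Rdiv [(ln _ * _ * _)%Re]Rmult_assoc Rinv_l; lra.
Qed.

Lemma size_set_coll k (I : sat_star k) : size (set_coll I) = (2 ^ (nvar I).+1).+1.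
Proof.
by rewrite !size_cat !size_map !size_evaluations ?xevals_all ?yevals_all // expnS /=; lia.
Qed.

Lemma set_ground_small k (I : sat_star k) : 0 < k ->
  (INR (size (set_ground I)) < log2 (INR (size (set_coll I))) ^ (3 * k + 2))%Re.
Proof.
move=> Hk; rewrite size_set_coll size_iota.
have := size_clauses I; move: (size (clauses I)) => m; move: (nvar I) => n Hc.
set L := log2 _.
have L1 : (INR n.+1 <= L)%Re by apply: log2_pow2_le; apply: leqnSn.
have L2 : (3 / 2 <= L)%Re.
  have P : 0 < 2 ^ n by rewrite expn_gt0.
  by apply: log2_3_gt; rewrite ltnS expnS; lia.
(* Without variables there is at most one clause, hence at most three elements, and
   [(3/2)^3 > 3]. *)
case: (posnP n) => Hn.
  apply: (@Rle_lt_trans _ 3).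
    have H3 : 2 + (n + n) + (n + n) + m <= 3.
      by move: Hc; rewrite Hn /= muln0 exp1n; lia.
    by have := INR_le H3; rewrite /=; lra.
  apply: (@Rlt_le_trans _ ((3 / 2) ^ 3)); first by rewrite /=; lra.
  apply: (@Rle_trans _ ((3 / 2) ^ (3 * k + 2))).
    by apply: Rle_pow; [lra|apply/leP; lia].
  by apply: pow_incr; lra.
(* For [n >= 1], [4n + 1 <= (n + 1)^3] bounds the number of clauses by [(n + 1)^(3k)], which also
   bounds the number of other elements; the extra exponent 2 pays for the sum, as
   [(n + 1)^2 > 2]. *)
have H : 2 + (n + n) + (n + n) + m < n.+1 ^ (3 * k + 2).
  have H4 : (4 * n).+1 <= n.+1 ^ 3 by rewrite !expnS expn0; nia.
  have H5 : m <= n.+1 ^ (3 * k).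
    by rewrite expnM; apply: leq_trans Hc _; rewrite leq_exp2r.
  have H6 : 2 + (n + n) + (n + n) <= n.+1 ^ (3 * k).
    apply: (@leq_trans (n.+1 ^ 3)); first by rewrite !expnS expn0; nia.
    by rewrite leq_pexp2l //; lia.
  have H7 : 0 < n.+1 ^ (3 * k) by rewrite expn_gt0.
  rewrite expnD !expnS expn0; nia.
apply: (@Rlt_le_trans _ (INR (n.+1 ^ (3 * k + 2)))); first by apply: lt_INR; apply/ltP.
rewrite INR_expn; apply: pow_incr; split=> //; exact: pos_INR.
Qed.

(** * The reduction and its running time *)

Definition reduction (k : nat) (hk : 0 < k) (I : instance (SatStarProblem k)) :
    instance (BigTwoDisjointSets (3 * k + 2)) :=
  BigDisjointSets (iota_uniq _ _ : uniq (set_ground I)) (set_coll_sets I)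
    (set_coll_sub I) (set_coll_distinct I) (set_ground_small I hk).

Lemma reduction_quasilinear (k : nat) (hk : 0 < k) : quasilinear_time (reduction hk).
Proof.
exists (compile 0 reduction_cmd).
(* The running time is chosen from the existence statement, which also bounds it. *)
exists (fun I : instance (SatStarProblem k) =>
  proj1_sig (constructive_indefinite_description _ (reduction_run I))); split.
  move=> I; case: constructive_indefinite_description => t [cf [Hr _ Ho]] /=.
  by exists cf.
have [B HB] : exists B, forall I : sat_star k, value_bound I <= B * (nvar I).+1 ^ k.
  by exists (18 + k.+1 * 4 ^ k) => I; apply: value_bound_le.
(* Since [2^(n+1) <= s] and [ln 2 > 1/2], each of the [2k] factors [n + 1] in the squared value
   bound is at most [2 * ln s]; this gives the exponent [2k] of the logarithm and the factor
   [2^(2k)]. *)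
exists (INR (320 * B ^ 2) * 2 ^ (2 * k))%Re, (2 * k), 0 => I _.
cbv beta; case: constructive_indefinite_description => t Hp; rewrite /proj1_sig.
case: Hp => cf [_ Ht _].
have HV := HB I.
have Hs := isize_ge I; move: (isize I) Hs => s Hs.
set n := nvar I in Ht Hs HV *.
have {}Ht : t <= 320 * B ^ 2 * (n.+1 ^ (2 * k) * s).
  apply: leq_trans Ht _; rewrite mulnA; apply: leq_mul => //.
  by rewrite -mulnA leq_mul2l [2 * k]mulnC expnM -expnMn leq_exp2r.
have Hn : (INR n.+1 <= 2 * ln (INR s))%Re.
  have := ln_pow2_le Hs; have := ln_lt_2; have := pos_INR n.+1; nra.
move: (320 * B ^ 2) Ht => C /INR_le; rewrite !mult_INR INR_expn => H.
apply: Rle_trans H _; rewrite Rmult_assoc.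
have PC := pos_INR C; have Ps := pos_INR s.
apply: Rmult_le_compat_l => //.
rewrite [(INR s * _)%Re]Rmult_comm -Rmult_assoc -Rpow_mult_distr.
apply: Rmult_le_compat_r => //; apply: pow_incr; split=> //; exact: pos_INR.
Qed.

Theorem theorem2 (k : nat) (hk : 1 <= k) :
  exists c : nat, ql_reducible (SatStarProblem k) (BigTwoDisjointSets c).
Proof.
exists (3 * k + 2), (reduction hk); split; first exact: reduction_quasilinear.
by move=> I; apply: set_coll_answer.
Qed.
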